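(* Let $\mathcal{H}_1$ and $\mathcal{H}_2$ be two real Hilbert spaces, and let $C\subset\mathcal{H}_1$ and $Q\subset\mathcal{H}_2$ be nonempty, closed and convex subsets. Let $X$ be a Banach space, and let $\varphi:\mathcal{H}_1\times X\to\mathbb{R}$ and $\psi:\mathcal{H}_2\times X\to\mathbb{R}$ be two functions. Let $\mathcal{B}_1:\mathcal{H}_1\times X\to 2^{\mathcal{H}_1}$ and $\mathcal{B}_2:\mathcal{H}_2\times X\to 2^{\mathcal{H}_2}$ be two strict multivalued mappings, and let $A:\mathcal{H}_1\to\mathcal{H}_2$ be a bounded linear operator. Then the family $\mathcal{PSMVIP}$ of parametric split multivalued variational inequality problems associated with these data is LP well-posed in the generalized sense if and only if for each $p\in X$, the solution set $S_p$ of (PSMVIP$_p$) is nonempty and compact and $$H(S_p(\delta,\epsilon),S_p)\to 0 \text{ as } (\delta,\epsilon)\to(0,0).$$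
   Context: Data: real Hilbert spaces $\mathcal{H}_1,\mathcal{H}_2$; sets $C\subset\mathcal{H}_1$, $Q\subset\mathcal{H}_2$; a Banach space $X$; functions $\varphi:\mathcal{H}_1\times X\to\mathbb{R}$, $\psi:\mathcal{H}_2\times X\to\mathbb{R}$; multivalued mappings $\mathcal{B}_i:\mathcal{H}_i\times X\to 2^{\mathcal{H}_i}$ ($i=1,2$); a bounded linear operator $A:\mathcal{H}_1\to\mathcal{H}_2$. The product $\mathcal{H}_1\times\mathcal{H}_2$ carries its usual Hilbert space structure. A multivalued mapping is strict if all its values are nonempty. Hausdorff metric: for nonempty sets $M,N$ in a Hilbert space, $d(a,N)=\inf_{b\in N}\|a-b\|$, $D(M,N)=\sup_{a\in M}d(a,N)$, $H(M,N)=\max\{D(M,N),D(N,M)\}$ (values in $[0,+\infty]$). For $p\in X$, problem (PSMVIP$_p$) is: find $(x^*,y^* )\in\mathcal{H}_1\times\mathcal{H}_2$ for which there exists $(u^*,v^* )\in\mathcal{B}_1(x^*,p)\times\mathcal{B}_2(y^*,p)$ such that $x^*\in C$, $y^*\in Q$, $y^*=Ax^*$, $\langle u^*,x^*-x\rangle+\varphi(x^*,p)-\varphi(x,p)\le0$ for all $x\in C$, and $\langle v^*,y^*-y\rangle+\psi(y^*,p)-\psi(y,p)\le0$ for all $y\in Q$. Its solution set is $S_p$. $\mathcal{PSMVIP}$ denotes the family of problems $\{(\mathrm{PSMVIP}_p):p\in X\}$. Let $p\in X$ and $\{p_n\}\subset X$ with $p_n\to p$. A sequence $\{(x_n,y_n)\}\subset\mathcal{H}_1\times\mathcal{H}_2$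 is a generalized approximating sequence for (PSMVIP$_p$) corresponding to $\{p_n\}$ if there exist $u_n\in\mathcal{B}_1(x_n,p_n)$, $v_n\in\mathcal{B}_2(y_n,p_n)$ and real numbers $\epsilon_n>0$ with $\epsilon_n\to0$ such that, for every $n$, $d(x_n,C)\le\epsilon_n$, $d(y_n,Q)\le\epsilon_n$, $\|y_n-Ax_n\|\le\epsilon_n$, $\langle u_n,x_n-x\rangle+\varphi(x_n,p_n)-\varphi(x,p_n)\le\epsilon_n$ for all $x\in C$, and $\langle v_n,y_n-y\rangle+\psi(y_n,p_n)-\psi(y,p_n)\le\epsilon_n$ for all $y\in Q$. $\mathcal{PSMVIP}$ is LP (Levitin-Polyak) well-posed in the generalized sense if for each $p\in X$, $S_p$ is nonempty and for each sequence $\{p_n\}\subset X$ with $p_n\to p$, every generalized approximating sequence for (PSMVIP$_p$) corresponding to $\{p_n\}$ has a subsequence which converges (in norm) to some element of $S_p$. For $p\in X$ and $\delta,\epsilon>0$, $S_p(\delta,\epsilon)$ is the union, over all $q$ in the closed ball $\mathbb{B}(p,\delta)\subset X$ of center $p$ and radius $\delta$, of the sets of all $(z,w)\in\mathcal{H}_1\times\mathcal{H}_2$ such that $d(z,C)\le\epsilon$, $d(w,Q)\le\epsilon$, $\|w-Az\|\le\epsilon$, and there exist $u\in\mathcal{B}_1(z,q)$, $v\in\mathcal{B}_2(w,q)$ with $\langle u,z-x\rangle+\varphi(z,q)-\varphi(x,q)\le\epsilon$ for all $x\in C$ and $\langle v,w-y\rangle+\psi(w,q)-\psi(y,q)\le\epsilon$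 for all $y\in Q$. *)

(* Defs.v *)
From HB Require Import structures.
From mathcomp Require Import all_boot all_order all_algebra sesquilinear.
From mathcomp Require Import all_classical all_reals all_analysis.
From mathcomp Require Import ring lra.

Set Implicit Arguments.
Unset Strict Implicit.
Unset Printing Implicit Defensive.

Import Order.TTheory GRing.Theory Num.Theory.
Import numFieldNormedType.Exports.

Local Open Scope classical_set_scope.
Local Open Scope ring_scope.

(* Over [R : realType], [{dot V for idfun}] is the type of positive definite
   symmetric bilinear forms on [V]. *)
HB.mixin Record NormedModule_hasInner (R : realType) V & NormedModule R V := {
  inner : {dot V for (@idfun R)};
  innerxx : forall x : V, inner x x = `|x| ^+ 2
}.

#[short(type="hilbertType")]
HB.structure Definition Hilbert (R : realType) :=
  {V of CompleteNormedModule R V & NormedModule_hasInner R V}.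

(* An alias for the Cartesian product, on which the library already puts the
   sup norm. *)
Definition hprod (R : realType) (H1 H2 : hilbertType R) : Type :=
  (H1 * H2)%type.

Section hilbert_product.
Context {R : realType} {H1 H2 : hilbertType R}.

HB.instance Definition _ := GRing.Lmodule.copy (hprod H1 H2) (H1 * H2)%type.

Let hnorm (z : hprod H1 H2) : R := Num.sqrt (`|z.1| ^+ 2 + `|z.2| ^+ 2).

Let sqrt_minkowski (a b c d : R) : 0 <= a -> 0 <= b -> 0 <= c -> 0 <= d ->
  Num.sqrt ((a + c) ^+ 2 + (b + d) ^+ 2) <=
  Num.sqrt (a ^+ 2 + b ^+ 2) + Num.sqrt (c ^+ 2 + d ^+ 2).
Proof.
move=> a0 b0 c0 d0.
set s := Num.sqrt (a ^+ 2 + b ^+ 2); set t := Num.sqrt (c ^+ 2 + d ^+ 2).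
have s0 : 0 <= s by exact: sqrtr_ge0.
have t0 : 0 <= t by exact: sqrtr_ge0.
have s2 : s ^+ 2 = a ^+ 2 + b ^+ 2 by rewrite sqr_sqrtr// addr_ge0// sqr_ge0.
have t2 : t ^+ 2 = c ^+ 2 + d ^+ 2 by rewrite sqr_sqrtr// addr_ge0// sqr_ge0.
have cs : a * c + b * d <= s * t.
  have : (a * c + b * d) ^+ 2 <= (s * t) ^+ 2.
    by rewrite exprMn s2 t2; have := sqr_ge0 (a * d - b * c); nra.
  by rewrite ler_pXn2r// nnegrE ?addr_ge0 ?mulr_ge0.
rewrite -[leRHS]ger0_norm ?addr_ge0// -sqrtr_sqr ler_wsqrtr//.
rewrite [leRHS]sqrrD s2 t2; nra.
Qed.

Let hnormD (z w : hprod H1 H2) : hnorm (z + w) <= hnorm z + hnorm w.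
Proof.
apply: le_trans (sqrt_minkowski _ _ _ _) => //.
by rewrite ler_wsqrtr// lerD// ler_pXn2r// ?nnegrE ?addr_ge0// ler_normD.
Qed.

Let hnormZ (l : R) (z : hprod H1 H2) : hnorm (l *: z) = `|l| * hnorm z.
Proof.
rewrite /hnorm /= !normrZ !exprMn -mulrDr sqrtrM ?sqr_ge0//.
by rewrite sqrtr_sqr normr_id.
Qed.

Let hnorm0_eq0 (z : hprod H1 H2) : hnorm z = 0 -> z = 0.
Proof.
move=> /eqP; rewrite sqrtr_eq0 => z0.
have {z0} : `|z.1| ^+ 2 + `|z.2| ^+ 2 == 0.
  by rewrite eq_le z0 addr_ge0// sqr_ge0.
rewrite paddr_eq0 ?sqr_ge0// !sqrf_eq0 !normr_eq0.
by case: z => x y /= /andP[/eqP-> /eqP->].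
Qed.

HB.instance Definition _ :=
  Lmodule_isNormed.Build R (hprod H1 H2) hnormD hnormZ hnorm0_eq0.

Lemma hprod_normE (z : hprod H1 H2) :
  `|z| = Num.sqrt (`|z.1| ^+ 2 + `|z.2| ^+ 2).
Proof. by []. Qed.

Lemma hprod_norm_fst (z : hprod H1 H2) : `|z.1| <= `|z|.
Proof.
rewrite hprod_normE -[leLHS]normr_id -sqrtr_sqr ler_wsqrtr//.
by rewrite lerDl sqr_ge0.
Qed.

Lemma hprod_norm_snd (z : hprod H1 H2) : `|z.2| <= `|z|.
Proof.
rewrite hprod_normE -[leLHS]normr_id -sqrtr_sqr ler_wsqrtr//.
by rewrite lerDr sqr_ge0.
Qed.

Lemma hprod_norm_le (z : hprod H1 H2) : `|z| <= `|z.1| + `|z.2|.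
Proof.
rewrite hprod_normE -[leRHS]ger0_norm ?addr_ge0// -sqrtr_sqr ler_wsqrtr//.
have := normr_ge0 z.1; have := normr_ge0 z.2; nra.
Qed.

Let hprod_complete (F : set_system (hprod H1 H2)) :
  ProperFilter F -> cauchy F -> cvg F.
Proof.
move=> FF /cauchy_ballP Fc.
have /cauchy_cvg/cvg_ex[a Fa] : cauchy (fst @ F).
  apply/cauchy_ballP => e e0; near_simpl; apply: filterS (Fc e e0) => -[z w] /=.
  rewrite -!ball_normE /=; apply: le_lt_trans; exact: (hprod_norm_fst (z - w)).
have /cauchy_cvg/cvg_ex[b Fb] : cauchy (snd @ F).
  apply/cauchy_ballP => e e0; near_simpl; apply: filterS (Fc e e0) => -[z w] /=.
  rewrite -!ball_normE /=; apply: le_lt_trans; exact: (hprod_norm_snd (z - w)).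
apply/cvg_ex; exists ((a, b) : hprod H1 H2).
apply/cvgrPdist_lt => /= _/posnumP[e]; near=> z.
apply: le_lt_trans (hprod_norm_le _) _; rewrite [ltRHS]splitr ltrD//=.
- by near: z; move/cvgrPdist_lt : Fa; exact.
- by near: z; move/cvgrPdist_lt : Fb; exact.
Unshelve. all: by end_near. Qed.

HB.instance Definition _ :=
  Uniform_isComplete.Build (hprod H1 H2) hprod_complete.

Definition hprod_inner (z w : hprod H1 H2) : R :=
  inner z.1 w.1 + inner z.2 w.2.

Let hprod_inner_bilinear :
  bilinear_for ( *%R ) (@idfun R \; *%R) hprod_inner.
Proof.
split=> [u a x y|u a x y] /=; rewrite /hprod_inner /=.
  by rewrite !linearPl /= mulrDr; ring.
by rewrite !linearP /= mulrDr; ring.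
Qed.

HB.instance Definition _ := bilinear_isBilinear.Build R (hprod H1 H2)
  (hprod H1 H2) R ( *%R ) (@idfun R \; *%R) hprod_inner hprod_inner_bilinear.
Let hprod_inner_sym (z w : hprod H1 H2) :
  hprod_inner z w = (-1) ^+ false * idfun (hprod_inner w z).
Proof.
rewrite expr0 mul1r /= /hprod_inner.
by congr (_ + _); rewrite hermitian_subproof expr0 mul1r.
Qed.
HB.instance Definition _ := isHermitianSesquilinear.Build R (hprod H1 H2)
  false (@idfun R) hprod_inner hprod_inner_sym.

Let hprod_inner_gt0 (z : hprod H1 H2) : z != 0 -> 0 < hprod_inner z z.
Proof.
move=> z0; rewrite /hprod_inner !innerxx.
have n0 : `|z| != 0 by rewrite normr_eq0.
rewrite lt_neqAle addr_ge0 ?sqr_ge0// andbT eq_sym.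
by apply: contra n0 => /eqP; rewrite hprod_normE => ->; rewrite sqrtr0.
Qed.
HB.instance Definition _ :=
  isDotProduct.Build R (hprod H1 H2) hprod_inner hprod_inner_gt0.

Let hprod_innerxx (z : hprod H1 H2) :
  (hprod_inner : {dot _ for (@idfun R)}) z z = `|z| ^+ 2.
Proof.
by rewrite /= /hprod_inner !innerxx hprod_normE sqr_sqrtr ?addr_ge0 ?sqr_ge0.
Qed.
HB.instance Definition _ :=
  NormedModule_hasInner.Build R (hprod H1 H2) hprod_innerxx.

End hilbert_product.

Section hausdorff_distance.
Context {R : realType} {H : hilbertType R}.
Local Open Scope ereal_scope.

(* [+oo] when [N] is empty. *)
Definition dist_to (N : set H) (a : H) : \bar R :=
  ereal_inf [set `|a - b|%:E | b in N].

Definition excess (M N : set H) : \bar R :=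
  ereal_sup [set dist_to N a | a in M].

Definition hausdorff_dist (M N : set H) : \bar R :=
  Order.max (excess M N) (excess N M).

End hausdorff_distance.

Section PSMVIP.
Context {R : realType} {H1 H2 : hilbertType R} {X : completeNormedModType R}.
Variables (C : set H1) (Q : set H2) (phi : H1 -> X -> R) (psi : H2 -> X -> R).
Variables (B1 : H1 -> X -> set H1) (B2 : H2 -> X -> set H2) (A : H1 -> H2).

Definition sol_set (p : X) : set (hprod H1 H2) :=
  [set z | exists u v, [/\ B1 z.1 p u, B2 z.2 p v,
    [/\ C z.1, Q z.2 & z.2 = A z.1],
    forall x, C x -> inner u (z.1 - x) + phi z.1 p - phi x p <= 0 &
    forall y, Q y -> inner v (z.2 - y) + psi z.2 p - psi y p <= 0]].

Definition approx_sol (q : X) (e : R) (z : hprod H1 H2) (u : H1) (v : H2) :=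
  [/\ B1 z.1 q u, B2 z.2 q v,
    [/\ (dist_to C z.1 <= e%:E)%E, (dist_to Q z.2 <= e%:E)%E &
        `|z.2 - A z.1| <= e],
    forall x, C x -> inner u (z.1 - x) + phi z.1 q - phi x q <= e &
    forall y, Q y -> inner v (z.2 - y) + psi z.2 q - psi y q <= e].

Definition generalized_approximating (p_ : nat -> X)
    (z_ : nat -> hprod H1 H2) :=
  exists (u_ : nat -> H1) (v_ : nat -> H2) (e_ : nat -> R),
    [/\ forall n, 0 < e_ n, e_ @ \oo --> (0 : R) &
        forall n, approx_sol (p_ n) (e_ n) (z_ n) (u_ n) (v_ n)].

Definition LP_well_posed_generalized :=
  forall p : X, sol_set p !=set0 /\
    forall p_ : nat -> X, p_ @ \oo --> p ->
    forall z_ : nat -> hprod H1 H2, generalized_approximating p_ z_ ->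
    exists2 s : nat -> nat, increasing_seq s &
      exists2 z, sol_set p z & (z_ \o s) @ \oo --> z.

Definition approx_set (p : X) (d e : R) : set (hprod H1 H2) :=
  \bigcup_(q in closed_ball_ Num.norm p d)
    [set z | exists u v, approx_sol q e z u v].

End PSMVIP.

(* Main.v *)
Require Import Defs.
From mathcomp Require Import all_boot all_order all_algebra.
From mathcomp Require Import all_classical all_reals all_analysis.
From mathcomp Require Import lra.

(** Everything rests on reading [H(S_p(d, e), S_p) -> 0] as a statement about
points. Since [S_p] is contained in every [S_p(d, e)], the Hausdorff distance
is just the excess of [S_p(d, e)] over [S_p]; and since [S_p(d, e)] grows with
[d] and [e], the convergence says that for every [eps > 0] there is [d > 0]
such that each point of [S_p(d, d)] is within [eps] of a point of [S_p]
([hausdorff_dist_cvg0P]). Sequences enter through two remarks: a sequence whose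
[n]-th term lies in [S_p(1/(n+1), 1/(n+1))] is a generalized approximating
sequence for some [p_n -> p] ([approx_set_generalized_approximating]), and
conversely a generalized approximating sequence lies eventually in each
[S_p(d, d)] ([generalized_approximating_near_approx_set]).

If the family is well-posed, a sequence in [S_p] is in particular a generalized
approximating sequence, so [S_p] is sequentially compact, hence compact
([seq_compact_compact]). If the distance did not tend to zero, some
[z_n] in [S_p(1/(n+1), 1/(n+1))] would all stay at distance at least [eps] from
[S_p], although a subsequence converges to a point of [S_p].

Conversely, the distance from the terms of a generalized approximating sequence
to [S_p] tends to zero, and a sequence whose distance to a compact set tends to
zero has a subsequence converging in that set
([compact_attracting_subseq]). *)

Set Implicit Arguments.
Unset Strict Implicit.
Unset Printing Implicit Defensive.

Import Order.TTheory GRing.Theory Num.Theory.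
Import numFieldNormedType.Exports.

Local Open Scope classical_set_scope.
Local Open Scope ring_scope.

(** * Sequential compactness *)

Lemma increasing_seq_geid (s : nat -> nat) :
  increasing_seq s -> forall n, (n <= s n)%N.
Proof.
move=> /increasing_seqP sS; elim=> // n /leq_ltn_trans; apply.
by have := sS n; rewrite ltEnat.
Qed.

Lemma increasing_seq_cvgnoo (s : nat -> nat) :
  increasing_seq s -> s @ \oo --> \oo.
Proof.
move=> /increasing_seq_geid s_ge P [N _ NP]; exists N => // n /= Nn.
by apply: NP; rewrite /= (leq_trans Nn).
Qed.

(** An ultrafilter on a sequentially compact set contains arbitrarily small
balls: otherwise it contains the complement of every ball of some radius [e],
and one can pick inductively points of [K] that are pairwise [e]-separated. *)
Lemma seq_compact_totally_bounded {R : realType} {V : normedModType R}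
    (K : set V) (F : set_system V) :
  (forall z_ : nat -> V, (forall n, K (z_ n)) ->
     exists2 s : nat -> nat, increasing_seq s &
       exists2 z, K z & (z_ \o s) @ \oo --> z) ->
  UltraFilter F -> F K -> forall e : R, 0 < e -> exists x, F (ball x e).
Proof.
move=> seqK FU FK e e0; apply: contrapT => nF.
have FC x : F (~` ball x e).
  by have [Fx|//] := in_ultra_setVsetC (ball x e) FU; case: nF; exists x.
pose far (l : seq V) := [set x | K x /\ forall y, y \in l -> ~ ball y e x].
have Ffar l : F (far l).
  elim: l => [|y l Fl]; first by apply: filterS FK => x Kx; split.
  apply: filterS (filterI (FC y) Fl) => x [yx [Kx lx]]; split => // y'.
  by rewrite inE => /predU1P[->//|/lx].
(* The list [l_ n] records the points chosen so far, latest first, so that each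
   new point can be taken far from all the previous ones. *)
have next l : {l' | exists2 x, far l x & l' = x :: l}.
  by apply: cid; have [x lx] := filter_ex (Ffar l); exists (x :: l), x.
have [l_ [_ /= l_S]] := dependent_choice next [::].
have /choice[z_ z_P] n : exists x, far (l_ n) x /\ l_ n.+1 = x :: l_ n.
  by have [x ? ?] := l_S n; exists x.
have mem m n : (m < n)%N -> z_ m \in l_ n.
  elim: n => // n IH; rewrite ltnS leq_eqVlt; have [_ ->] := z_P n.
  by move=> /predU1P[->|/IH]; rewrite inE ?eqxx// => ->; rewrite orbT.
have [n|s s_inc [z Kz z_z]] := seqK z_; first by have [[]] := z_P n.
have e20 : 0 < e / 2 by rewrite divr_gt0.
have /cvgrPdist_lt/(_ _ e20)[N _ Nz] := z_z.
have [[_ sep] _] := z_P (s N.+1).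
apply: (sep (z_ (s N))).
  by apply: mem; have /increasing_seqP/(_ N) := s_inc; rewrite ltEnat.
rewrite -ball_normE /=.
have := Nz N (leqnn N); have := Nz N.+1 (leqnSn N); rewrite /=.
have := ler_distD z (z_ (s N)) (z_ (s N.+1)); rewrite (distrC _ z).
by move=> + ? ?; lra.
Qed.

(** By the previous lemma every ultrafilter on [K] is Cauchy, hence convergent;
its limit is also the limit of a sequence in [K], so it belongs to [K]. *)
Lemma seq_compact_compact {R : realType} {V : completeNormedModType R}
    (K : set V) :
  (forall z_ : nat -> V, (forall n, K (z_ n)) ->
     exists2 s : nat -> nat, increasing_seq s &
       exists2 z, K z & (z_ \o s) @ \oo --> z) ->
  compact K.
Proof.
move=> seqK; rewrite compact_ultra.
suff lim_in (F : set_system V) : UltraFilter F -> F K ->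
    exists2 a, K a & F --> a.
  by move=> F FU FK; have [a] := lim_in F FU FK; exists a.
move=> FU FK.
have FC := seq_compact_totally_bounded seqK FU FK.
have /cvg_ex[a Fa] : cvg F by exact: cauchy_cvg (cauchy_exP F FC).
exists a => //.
have /choice[z_ z_P] n : exists x, K x /\ ball a n.+1%:R^-1 x.
  have Fan : F (ball a n.+1%:R^-1) by apply/Fa/nbhsx_ballx.
  exact: filter_ex (filterI FK Fan).
have [n|s s_inc [z Kz z_z]] := seqK z_; first by have [] := z_P n.
suff z_a : z_ @ \oo --> a.
  have /(cvg_unique (@norm_hausdorff _ _))/(_ z_z) -> // : z_ \o s @ \oo --> a.
  exact: cvg_comp (increasing_seq_cvgnoo s_inc) z_a.
apply/cvgrPdist_lt => e e0.
have := near_infty_natSinv_lt (PosNum e0); apply: filterS => n /=.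
by have [_] := z_P n; rewrite -ball_normE => /lt_trans; apply.
Qed.

(** If no point of [K] were a subsequential limit, each [z] in [K] would have a
neighbourhood that the sequence eventually stays uniformly away from; by
compactness the sequence would eventually stay uniformly away from [K]. *)
Lemma compact_attracting_subseq {R : realType} {V : normedModType R}
    (K : set V) (z_ : nat -> V) :
  compact K ->
  (forall e : R, 0 < e ->
     \forall n \near \oo, exists2 k, K k & `|z_ n - k| < e) ->
  exists2 s : nat -> nat, increasing_seq s &
    exists2 z, K z & (z_ \o s) @ \oo --> z.
Proof.
move=> /compact_near_coveringP cK zK; apply: contrapT => noz.
have far z : K z ->
    exists2 e : R, 0 < e & exists N, forall n, (N <= n)%N -> e < `|z_ n - z|.
  move=> Kz; apply: contrapT => nfar; apply: noz.
  (* Subsequences are extracted from the real sequence of distances to [z]. *)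
  have /cluster_eventually_cvg[s s_inc sz] :
      cluster ((fun n => `|z_ n - z|) @ \oo) (0 : R).
    apply/cluster_eventuallyP => e N e0; apply: contrapT => nN.
    apply: nfar; exists e => //; exists N => n Nn; rewrite ltNge.
    apply/negP => ne; apply: nN; exists n => //.
    by rewrite sub0r normrN normr_id.
  exists s => //; exists z => //; apply/cvgrPdist_lt => e e0.
  have /cvgrPdist_lt/(_ e e0) := sz; apply: filterS => n /=.
  by rewrite sub0r normrN normr_id distrC.
(* The index is a pair of a small radius and a large rank. *)
have := cK _ (filter_prod (0^'+ : set_system R) \oo)
  (fun en k => en.1 <= `|z_ en.2 - k|) _.
case=> [k Kk|[E M] /= [E0 Moo] EM].
  have [e e0 [N eN]] := far k Kk.
  have e20 : 0 < e / 2 by rewrite divr_gt0.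
  exists (ball k (e / 2), [set en : R * nat | en.1 < e / 2 /\ (N <= en.2)%N]).
    split; first exact: nbhsx_ballx.
    exists ([set d | d < e / 2], [set n | (N <= n)%N]) => //=.
    by split; [exact: nbhs_right_lt | exact: nbhs_infty_ge].
  move=> [k' [d n]] [] /=; rewrite -ball_normE /= => kk' [de /eN].
  have := ler_distD k' (z_ n) k; rewrite (distrC k').
  by move=> + ?; lra.
have [d [Ed /= d0]] := filter_ex (filterI E0 (nbhs_right_gt (0 : R))).
have [n [Mn [k Kk nk]]] := filter_ex (filterI Moo (zK _ d0)).
by have := EM (d, n) (conj Ed Mn) k Kk; rewrite /= leNgt nk.
Qed.

(** * Convergence to zero of the Hausdorff distance *)

Lemma dist_to_ge0 {R : realType} {H : hilbertType R} (N : set H) (a : H) :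
  (0 <= dist_to N a)%E.
Proof. by apply/ereal_infP => _ [b _ <-]; rewrite lee_fin. Qed.

Lemma dist_to_le0 {R : realType} {H : hilbertType R} (N : set H) (a : H) :
  N a -> (dist_to N a <= 0)%E.
Proof.
move=> Na; apply: ge_ereal_inf; exists 0%E => //; exists a => //.
by rewrite subrr normr0.
Qed.

Lemma dist_to_lt {R : realType} {H : hilbertType R} (N : set H) (a : H)
    (e : R) :
  (dist_to N a < e%:E)%E <-> exists2 b, N b & `|a - b| < e.
Proof.
split=> [/ereal_inf_ltP[_ [b Nb <-]]|[b Nb be]].
  by rewrite lte_fin; exists b.
by apply/ereal_inf_ltP; exists `|a - b|%:E => //; exists b.
Qed.

Lemma hausdorff_distE {R : realType} {H : hilbertType R} (M S : set H) :
  S !=set0 -> S `<=` M -> hausdorff_dist M S = excess M S.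
Proof.
move=> [a Sa] SM; apply/max_idPl.
have exSM : (excess S M <= 0)%E.
  by apply/ereal_supP => _ [b Sb <-]; apply/dist_to_le0/SM.
apply: (le_trans exSM); apply: (le_trans (dist_to_ge0 S a)).
by apply: ereal_sup_ubound; exists a => //; exact: SM.
Qed.

Lemma hausdorff_dist_ge0 {R : realType} {H : hilbertType R} (M S : set H) :
  S !=set0 -> (0 <= hausdorff_dist M S)%E.
Proof.
move=> [a Sa]; rewrite le_max; apply/orP; right.
apply: (le_trans (dist_to_ge0 M a)).
by apply: ereal_sup_ubound; exists a.
Qed.

(** For a family [M d e] of supersets of [S] that is nondecreasing in [d] and
[e], convergence of the extended real Hausdorff distance is a statement about
the diagonal members [M d d] alone. *)
Lemma hausdorff_dist_cvg0P {R : realType} {H : hilbertType R} (S : set H)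
    (M : R -> R -> set H) :
  S !=set0 ->
  (forall d e, 0 < d -> 0 < e -> S `<=` M d e) ->
  (forall d d' e e', d <= d' -> e <= e' -> M d e `<=` M d' e') ->
  hausdorff_dist (M t.1 t.2) S
    @[t --> within [set t : R * R | 0 < t.1 /\ 0 < t.2] (nbhs (0, 0))]
    --> (0 : \bar R)%E <->
  forall e : R, 0 < e ->
    exists2 d, 0 < d & forall z, M d d z -> exists2 k, S k & `|z - k| < e.
Proof.
move=> S0 SM Mmono; split=> [/fine_cvgP[Hfin /cvgrPdist_lt Hlim] e e0|near_S].
  have [[U V] /= [U0 V0] UV] := filterI Hfin (Hlim e e0).
  have right W : nbhs (0 : R) W -> \forall d \near 0^'+, W d.
    exact: cvg_within.
  have [d [[Ud Vd] /= d0]] := filter_ex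
    (filterI (filterI (right _ U0) (right _ V0)) (nbhs_right_gt (0 : R))).
  exists d => // z Mz; apply/dist_to_lt.
  have := UV (d, d) (conj Ud Vd) (conj d0 d0).
  rewrite /= sub0r normrN => -[Hd_fin].
  rewrite ger0_norm ?fine_ge0 ?hausdorff_dist_ge0// -lte_fin fineK//.
  apply: le_lt_trans; rewrite hausdorff_distE//; last exact: SM.
  by apply: ereal_sup_ubound; exists z.
have bound (e : R) : 0 < e -> \forall t \near within
    [set t : R * R | 0 < t.1 /\ 0 < t.2] (nbhs (0, 0)),
    (hausdorff_dist (M t.1 t.2) S <= e%:E)%E.
  move=> e0; have [d d0 dS] := near_S e e0.
  exists ([set x | x < d], [set x | x < d]).
    by split; exact: lt_nbhsl.
  move=> [x y] [/= xd yd] [x0 y0]; rewrite hausdorff_distE//; last exact: SM.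
  apply/ereal_supP => _ [z Mz <-]; apply/ltW/dist_to_lt/dS.
  by apply: Mmono Mz; exact: ltW.
apply/fine_cvgP; split.
  apply: filterS (bound 1 ltr01) => t Ht.
  by rewrite ge0_fin_numE ?hausdorff_dist_ge0// (le_lt_trans Ht) ?ltry.
apply/cvgrPdist_le => e e0; apply: filterS (bound e e0) => t Ht.
have H0 := hausdorff_dist_ge0 (M t.1 t.2) S0.
rewrite sub0r normrN ger0_norm ?fine_ge0// -lee_fin fineK//.
by rewrite ge0_fin_numE// (le_lt_trans Ht) ?ltry.
Qed.

(** * Approximate solutions *)

Section PSMVIP_theory.
Context {R : realType} {H1 H2 : hilbertType R} {X : completeNormedModType R}.
Variables (C : set H1) (Q : set H2) (phi : H1 -> X -> R) (psi : H2 -> X -> R).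
Variables (B1 : H1 -> X -> set H1) (B2 : H2 -> X -> set H2) (A : H1 -> H2).

Lemma approx_sol_le (q : X) (e e' : R) (z : hprod H1 H2) (u : H1) (v : H2) :
  e <= e' -> approx_sol C Q phi psi B1 B2 A q e z u v ->
  approx_sol C Q phi psi B1 B2 A q e' z u v.
Proof.
move=> ee' [B1u B2v [zC zQ zA] uP vP].
have eeE : (e%:E <= e'%:E)%E by rewrite lee_fin.
split=> //.
- split; [exact: le_trans zC _ | exact: le_trans zQ _ | exact: le_trans zA _].
- by move=> x /uP/le_trans; apply.
- by move=> y /vP/le_trans; apply.
Qed.

Lemma sol_set_approx_sol (p : X) (z : hprod H1 H2) :
  sol_set C Q phi psi B1 B2 A p z ->
  exists u v, approx_sol C Q phi psi B1 B2 A p 0 z u v.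
Proof.
move=> [u [v [B1u B2v [zC zQ zA] uP vP]]]; exists u, v; split=> //.
split; [exact: dist_to_le0 zC | exact: dist_to_le0 zQ |].
by rewrite zA subrr normr0.
Qed.

Lemma approx_set_le (p : X) (d d' e e' : R) : d <= d' -> e <= e' ->
  approx_set C Q phi psi B1 B2 A p d e `<=`
  approx_set C Q phi psi B1 B2 A p d' e'.
Proof.
move=> dd' ee' z [q pq [u [v uv]]]; exists q; first exact: le_trans pq dd'.
by exists u, v; exact: approx_sol_le uv.
Qed.

Lemma sol_set_sub_approx_set (p : X) (d e : R) : 0 <= d -> 0 <= e ->
  sol_set C Q phi psi B1 B2 A p `<=` approx_set C Q phi psi B1 B2 A p d e.
Proof.
move=> d0 e0 z /sol_set_approx_sol[u [v uv]].
exists p; first by rewrite /closed_ball_ /= subrr normr0.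
by exists u, v; exact: approx_sol_le uv.
Qed.

(** The parameters [p_ n] are the points of the closed balls around [p] that
witness membership in the union defining the approximate solution sets. *)
Lemma approx_set_generalized_approximating (p : X) (z_ : nat -> hprod H1 H2) :
  (forall n,
     approx_set C Q phi psi B1 B2 A p (harmonic n) (harmonic n) (z_ n)) ->
  exists2 p_ : nat -> X, p_ @ \oo --> p &
    generalized_approximating C Q phi psi B1 B2 A p_ z_.
Proof.
move=> zP.
have /choice[p_ p_P] n : exists q, closed_ball_ Num.norm p (harmonic n : R) q /\
    exists u v, approx_sol C Q phi psi B1 B2 A q (harmonic n) (z_ n) u v.
  by have [q pq uv] := zP n; exists q.
have /choice[u_ u_P] n : exists u, exists v,
    approx_sol C Q phi psi B1 B2 A (p_ n) (harmonic n) (z_ n) u v.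
  by have [_ [u [v uv]]] := p_P n; exists u, v.
have [v_ v_P] := choice u_P.
exists p_.
  apply/cvgrPdist_lt => e e0.
  apply: filterS (near_infty_natSinv_lt (PosNum e0)) => n.
  by apply: le_lt_trans; have [] := p_P n.
exists u_, v_, harmonic; split => //.
- by move=> n; rewrite /= invr_gt0 ltr0n.
- exact: cvg_harmonic.
Qed.

Lemma generalized_approximating_near_approx_set (p : X) (p_ : nat -> X)
    (z_ : nat -> hprod H1 H2) (d : R) : 0 < d -> p_ @ \oo --> p ->
  generalized_approximating C Q phi psi B1 B2 A p_ z_ ->
  \forall n \near \oo, approx_set C Q phi psi B1 B2 A p d d (z_ n).
Proof.
move=> d0 /cvgrPdist_le/(_ d d0) p_p [u_ [v_ [e_ [e_gt0 e_0 zP]]]].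
have e_d : \forall n \near \oo, e_ n < d by exact: cvgr_lt e_0 _ d0.
apply: filterS (filterI p_p e_d) => n [pn ed]; exists (p_ n) => //.
by exists (u_ n), (v_ n); apply: approx_sol_le (zP n); exact: ltW.
Qed.

End PSMVIP_theory.

(** * Characterization of well-posedness *)

Theorem theorem14 (R : realType) (H1 H2 : hilbertType R)
    (X : completeNormedModType R) (C : set H1) (Q : set H2)
    (phi : H1 -> X -> R) (psi : H2 -> X -> R)
    (B1 : H1 -> X -> set H1) (B2 : H2 -> X -> set H2)
    (A : {linear H1 -> H2})
    (C_neq0 : C !=set0) (C_closed : closed C) (C_convex : convex_set C)
    (Q_neq0 : Q !=set0) (Q_closed : closed Q) (Q_convex : convex_set Q)
    (B1_strict : forall x p, B1 x p !=set0)
    (B2_strict : forall y p, B2 y p !=set0)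
    (A_bounded : exists M : R, forall x, `|A x| <= M * `|x|) :
  LP_well_posed_generalized C Q phi psi B1 B2 A <->
  forall p : X,
    [/\ sol_set C Q phi psi B1 B2 A p !=set0,
        compact (sol_set C Q phi psi B1 B2 A p) &
        hausdorff_dist (approx_set C Q phi psi B1 B2 A p t.1 t.2)
                       (sol_set C Q phi psi B1 B2 A p)
          @[t --> within [set t : R * R | 0 < t.1 /\ 0 < t.2] (nbhs (0, 0))]
          --> (0 : \bar R)%E].
Proof.
have sol_sub p (d e : R) : 0 < d -> 0 < e ->
    sol_set C Q phi psi B1 B2 A p `<=` approx_set C Q phi psi B1 B2 A p d e.
  by move=> /ltW d0 /ltW e0; exact: sol_set_sub_approx_set.
split=> [wp p|conv p].
  have [S0 subseq] := wp p.
  have seq_lim (z_ : nat -> hprod H1 H2) :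
      (forall n,
         approx_set C Q phi psi B1 B2 A p (harmonic n) (harmonic n) (z_ n)) ->
      exists2 s : nat -> nat, increasing_seq s &
        exists2 z, sol_set C Q phi psi B1 B2 A p z & (z_ \o s) @ \oo --> z.
    move=> /approx_set_generalized_approximating[p_ p_p].
    exact: subseq.
  have harm_gt0 n : 0 < harmonic n :> R by rewrite /= invr_gt0 ltr0n.
  split => //.
    apply: seq_compact_compact => z_ Sz; apply: seq_lim => n.
    exact: sol_sub.
  apply/hausdorff_dist_cvg0P => //.
  - exact: sol_sub.
  - by move=> d d' f f'; exact: approx_set_le.
  move=> e e0; apply: contrapT => far.
  have /choice[z_ z_P] n : exists z,
      approx_set C Q phi psi B1 B2 A p (harmonic n) (harmonic n) z /\
      forall k, sol_set C Q phi psi B1 B2 A p k -> e <= `|z - k|.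
    apply: contrapT => nz; apply: far; exists (harmonic n) => // z Mz.
    apply: contrapT => nk; apply: nz; exists z; split => // k Sk.
    by rewrite leNgt; apply/negP => zk; apply: nk; exists k.
  have [n|s _ [k Sk zk]] := seq_lim z_; first by have [] := z_P n.
  have /cvgrPdist_lt/(_ e e0)[N _ /(_ N (leqnn N))] := zk.
  rewrite /= distrC ltNge; apply/negP; rewrite negbK.
  by have [_ ->] := z_P (s N).
have [S0 cS /hausdorff_dist_cvg0P near_S] := conv p.
split=> // p_ p_p z_ zP; apply: compact_attracting_subseq => // e e0.
have [|d d0 dS] := near_S S0 (sol_sub p) _ e e0.
  by move=> d d' f f'; exact: approx_set_le.
apply: filterS (generalized_approximating_near_approx_set d0 p_p zP) => n.
exact: dS.
Qed.
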